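(* The logic $\mathsf{wPL}$ is locally tabular but not uniformly locally tabular.
   Context: $\mathsf{wPL}=\mathsf{IPC}\oplus (q\to p)\vee\big(((p\to q)\to p)\to p\big)$ (Weak Peirce's Law). A logic $L$ is locally tabular if over each finite set of variables there are finitely many formulas up to $L$-equivalence; it is $n$-uniform if every formula is $L$-equivalent to one of implication depth $\le n$ (atoms/constants depth $0$, $\wedge,\vee$ take maximum, $d(\varphi\to\psi)=\max(d(\varphi),d(\psi))+1$); uniformly locally tabular if $n$-uniform for some $n$. *)

(* Defs.v *)
From Stdlib Require Import List Arith.
Import ListNotations.

Inductive form : Type :=
  | Var : nat -> form
  | Bot : form
  | Top : form
  | And : form -> form -> form
  | Or  : form -> form -> form
  | Imp : form -> form -> form.

Inductive ipc_axiom : form -> Prop :=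
  | AxK  a b   : ipc_axiom (Imp a (Imp b a))
  | AxS  a b c : ipc_axiom (Imp (Imp a (Imp b c)) (Imp (Imp a b) (Imp a c)))
  | AxA1 a b   : ipc_axiom (Imp (And a b) a)
  | AxA2 a b   : ipc_axiom (Imp (And a b) b)
  | AxA3 a b   : ipc_axiom (Imp a (Imp b (And a b)))
  | AxO1 a b   : ipc_axiom (Imp a (Or a b))
  | AxO2 a b   : ipc_axiom (Imp b (Or a b))
  | AxO3 a b c : ipc_axiom (Imp (Imp a c) (Imp (Imp b c) (Imp (Or a b) c)))
  | AxBot a    : ipc_axiom (Imp Bot a)
  | AxTop      : ipc_axiom Top.

(* A superintuitionistic logic given by IPC plus a set of extra axioms Ax,
   closed under substitution and modus ponens.  Closure under substitution
   is realized by taking all substitution instances of the extra axioms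
   (the IPC axioms are already schemes). *)
Fixpoint substf (s : nat -> form) (f : form) : form :=
  match f with
  | Var n => s n
  | Bot => Bot
  | Top => Top
  | And a b => And (substf s a) (substf s b)
  | Or a b => Or (substf s a) (substf s b)
  | Imp a b => Imp (substf s a) (substf s b)
  end.

Inductive ext_thm (Ax : form -> Prop) : form -> Prop :=
  | ThIPC f : ipc_axiom f -> ext_thm Ax f
  | ThAx s f : Ax f -> ext_thm Ax (substf s f)
  | ThMP a b : ext_thm Ax (Imp a b) -> ext_thm Ax a -> ext_thm Ax b.

Definition logic := form -> Prop.

Definition weak_peirce : form :=
  let p := Var 0 in let q := Var 1 in
  Or (Imp q p) (Imp (Imp (Imp p q) p) p).

Definition wPL : logic := ext_thm (fun f => f = weak_peirce).

Definition equivL (L : logic) (f g : form) : Prop :=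
  L (And (Imp f g) (Imp g f)).

Fixpoint vars (f : form) : list nat :=
  match f with
  | Var n => [n]
  | Bot | Top => []
  | And a b | Or a b | Imp a b => vars a ++ vars b
  end.

Definition locally_tabular (L : logic) : Prop :=
  forall X : list nat, exists reps : list form,
    forall f : form, incl (vars f) X ->
      exists g, In g reps /\ equivL L f g.

Fixpoint idepth (f : form) : nat :=
  match f with
  | Var _ | Bot | Top => 0
  | And a b | Or a b => Nat.max (idepth a) (idepth b)
  | Imp a b => S (Nat.max (idepth a) (idepth b))
  end.

Definition n_uniform (L : logic) (n : nat) : Prop :=
  forall f : form, exists g : form, idepth g <= n /\ equivL L f g.

Definition uniformly_locally_tabular (L : logic) : Prop :=
  exists n : nat, n_uniform L n.

(* Main.v *)
(** The point-generated subframes of the canonical frame of wPL are linear sums of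
    antichains.  A variable is mixed on at most one layer, so over finitely many
    variables the color of a point, together with the set of colors of its layer,
    determines the point up to bisimulation, which leaves finitely many finite
    models to check.  Uniformity fails on the infinite descending sum of
    two-point antichains in which the n-th variable splits the n-th layer: the
    unsplit point of layer n and the split point of layer n+1 carry the same
    variables and agree on all formulas of depth at most n, but "being in layer
    at most n" is definable. *)

Require Import Defs.
From Stdlib Require Import List Lia.
From mathcomp Require Import all_boot.
From mathcomp Require Import boolp classical_sets.

Set Implicit Arguments.
Unset Strict Implicit.
Unset Printing Implicit Defensive.

Local Open Scope classical_set_scope.

(** * Prime theories *)

Inductive ded (Ax T : set form) : form -> Prop :=
  | ded_thm f : ext_thm Ax f -> ded Ax T f
  | ded_hyp f : T f -> ded Ax T f
  | ded_mp a b : ded Ax T (Imp a b) -> ded Ax T a -> ded Ax T b.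

Lemma ded_axiom Ax T f : ipc_axiom f -> ded Ax T f.
Proof. by move=> h; apply/ded_thm/ThIPC. Qed.

Lemma ded_set0 Ax f : ded Ax set0 f -> ext_thm Ax f.
Proof. by elim=> // a b _ ha _ hb; apply: ThMP ha hb. Qed.

Lemma ded_sub Ax T U f : T `<=` U -> ded Ax T f -> ded Ax U f.
Proof.
move=> TU; elim=> [g h|g /TU h|a b _ ha _ hb].
- exact: ded_thm.
- exact: ded_hyp.
- exact: ded_mp ha hb.
Qed.

Lemma deduction Ax T a b : ded Ax (a |` T) b -> ded Ax T (Imp a b).
Proof.
have weaken g : ded Ax T g -> ded Ax T (Imp a g).
  by apply: ded_mp; apply/ded_axiom/AxK.
elim=> [g h|g [-> | h]|c d _ hc _ hd].
- exact/weaken/ded_thm.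
- apply: ded_mp (ded_axiom _ _ (AxK a a)).
  by apply: ded_mp (ded_axiom _ _ (AxK a (Imp a a))); apply/ded_axiom/AxS.
- exact/weaken/ded_hyp.
- by apply: ded_mp hd; apply: ded_mp hc; apply/ded_axiom/AxS.
Qed.

Definition prime_theory (Ax x : set form) : Prop :=
  [/\ forall f, ded Ax x f -> x f, ~ x Bot
    & forall a b, x (Or a b) -> x a \/ x b].

(** A deduction uses finitely many hypotheses, so one member of the chain supplies them all; the
    first alternative covers the empty chain. *)
Lemma ded_bigcup Ax T (F : set (set form)) f :
  total_on F subset -> ded Ax (T `|` \bigcup_(A in F) A) f ->
  ded Ax T f \/ exists2 A, F A & ded Ax (T `|` A) f.
Proof.
move=> Ftot; elim=> [g h|g [h|[A FA Ag]]|a b _ ha _ hb].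
- by left; apply: ded_thm.
- by left; apply: ded_hyp.
- by right; exists A => //; apply: ded_hyp; right.
- case: ha hb => [ha|[A FA ha]] [hb|[B FB hb]].
  + by left; apply: ded_mp ha hb.
  + right; exists B => //; apply: ded_mp hb.
    by apply: ded_sub ha; apply: subsetUl.
  + right; exists A => //; apply: (ded_mp ha).
    by apply: ded_sub hb; apply: subsetUl.
  + right; have [AB|BA] := Ftot _ _ FA FB.
    * exists B => //; apply: ded_mp hb.
      by apply: ded_sub ha; apply: setUS.
    * exists A => //; apply: (ded_mp ha).
      by apply: ded_sub hb; apply: setUS.
Qed.

Lemma prime_extension Ax T f : ~ ded Ax T f ->
  exists x, [/\ prime_theory Ax x, T `<=` x & ~ x f].
Proof.
move=> nTf.
(* [T] is joined outside [A] so that the empty chain also has an admissible union. *)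
have [F FP Ftot|A [nAf Amax]] := @Zorn_bigcup form (fun A => ~ ded Ax (T `|` A) f).
  by move=> /(ded_bigcup Ftot) [//|[A /FP]].
set x := T `|` A.
have inx g : ~ ded Ax (g |` x) f -> x g.
  move=> ng; right; apply: contrapT => nAg; apply: (Amax (g |` A)).
    by split=> [|/(_ g (or_introl erefl))]; first exact: subsetUr.
  by rewrite setUCA.
have xded g : ded Ax x g -> x g.
  move=> xg; apply: inx => /deduction h; apply: nAf; exact: ded_mp h xg.
exists x; split=> [|g ?|/(@ded_hyp Ax) //]; last by left.
split=> //.
  move=> /(@ded_hyp Ax) h; apply: nAf.
  by apply: ded_mp h; apply/ded_axiom/AxBot.
move=> a b /(@ded_hyp Ax) xab; apply: contrapT => /not_orP[na nb]; apply: nAf.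
have imp_of g : ~ x g -> ded Ax x (Imp g f).
  by move=> ng; apply: deduction; apply: contrapT => /inx.
apply: ded_mp xab; apply: ded_mp (imp_of _ nb); apply: ded_mp (imp_of _ na).
exact/ded_axiom/AxO3.
Qed.

Lemma prime_and Ax x a b : prime_theory Ax x -> x (And a b) <-> x a /\ x b.
Proof.
case=> xded _ _; split=> [/(@ded_hyp Ax) h|[/(@ded_hyp Ax) ha /(@ded_hyp Ax) hb]].
  by split; apply: xded; apply: ded_mp h; apply: ded_axiom; constructor.
by apply: xded; apply: ded_mp hb; apply: ded_mp ha; apply/ded_axiom/AxA3.
Qed.

Lemma prime_or Ax x a b : prime_theory Ax x -> x (Or a b) <-> x a \/ x b.
Proof.
case=> xded _ xor; split=> [/xor //|[]/(@ded_hyp Ax) h];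
  by apply: xded; apply: ded_mp h; apply: ded_axiom; constructor.
Qed.

Lemma prime_mp Ax x a b : prime_theory Ax x -> x (Imp a b) -> x a -> x b.
Proof.
by case=> xded _ _ hab ha; apply: xded; apply: ded_mp (ded_hyp _ hab) (ded_hyp _ ha).
Qed.

Lemma prime_imp Ax x a b : prime_theory Ax x ->
  x (Imp a b) <-> forall y, prime_theory Ax y -> x `<=` y -> y a -> y b.
Proof.
move=> xP; split=> [xab y yP /(_ _ xab)|h]; first exact: (prime_mp yP).
have [xded _ _] := xP; apply: xded; apply: deduction; apply: contrapT => nb.
have [y [yP xy]] := prime_extension nb; apply; apply: h => //; last by apply: xy; left.
by move=> g xg; apply: xy; right.
Qed.

(** * The canonical frame of wPL *)

Notation wPL_prime := (prime_theory (fun f => f = weak_peirce)).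

Lemma wPL_prime_peirce r p q : wPL_prime r ->
  r (Imp q p) \/ r (Imp (Imp (Imp p q) p) p).
Proof.
move=> rP; apply/(prime_or _ _ rP).
have [rded _ _] := rP; apply: rded; apply: ded_thm.
exact: (@ThAx (fun f => f = weak_peirce)
  (fun n => if n is 0 then p else q) _ erefl).
Qed.

(** The frame condition of weak Peirce's law: it makes strict inclusion above [r] a strict weak
    order. A failure yields [q] in [w] but not [z], [p] in [x] but not [w], and [s] in [z] but not
    [x], from which a violated instance of the law is built. *)
Lemma wPL_prime_layered r x z w :
  wPL_prime r -> wPL_prime x -> wPL_prime z -> wPL_prime w ->
  r `<=` x -> r `<=` w -> x `<` z -> w `<=` z \/ x `<=` w.
Proof.
move=> rP xP zP wP rx rw [xz nzx].
apply: contrapT => /not_orP[/existsNP[q /not_implyP[wq nzq]]].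
move=> /existsNP[p /not_implyP[xp nwp]].
move: nzx => /existsNP[s /not_implyP[zs nxs]].
(* [d] lies outside [w], and [p] and [Imp d q] jointly entail [d]; this turns the
   second disjunct of weak Peirce into membership of [d] in [x]. *)
pose s' := And s p; pose d := Or s' (And p (Imp s' q)).
have [/rw h|/rx h] := wPL_prime_peirce d q rP.
  have /(prime_or _ _ wP) := prime_mp wP h wq.
  by case=> /(prime_and _ _ wP)[].
have /(prime_or _ _ xP)[/(prime_and _ _ xP)[]//|/(prime_and _ _ xP)[_ /xz]] : x d.
  apply: (prime_mp xP h); apply/(prime_imp _ _ xP) => y yP xy ydq.
  apply/(prime_or _ _ yP); right; apply/(prime_and _ _ yP); split; first exact: xy.
  apply/(prime_imp _ _ yP) => t tP yt ts'; apply: (prime_mp tP (yt _ ydq)).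
  by apply/(prime_or _ _ tP); left.
move=> h'; apply: nzq; apply: (prime_mp zP h').
by apply/(prime_and _ _ zP); split=> //; apply: xz.
Qed.

Definition above (r x : set form) : Prop := wPL_prime x /\ r `<=` x.

(** By the layered condition, an equivalence above a fixed prime theory, with antichains as
    classes. *)
Definition same_layer (x y : set form) : Prop := ~ x `<` y /\ ~ y `<` x.

Lemma same_layer_refl x : same_layer x x.
Proof. by split=> -[]. Qed.

Lemma same_layer_sym x y : same_layer x y -> same_layer y x.
Proof. by case. Qed.

Lemma same_layer_sub x y : same_layer x y -> x `<=` y -> x = y.
Proof.
move=> [nxy _] xy; apply/seteqP; split=> //.
by apply: contrapT => nyx; apply: nxy.
Qed.

Lemma above_layered r x z w : wPL_prime r ->
  above r x -> above r z -> above r w -> x `<` z -> w `<=` z \/ x `<=` w.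
Proof. by move=> rP [xP rx] [zP rz] [wP rw]; apply: wPL_prime_layered rP _ _ _ _ _. Qed.

(** The layered condition is applied twice, moving first the lower point from [x] to [u], then the
    upper one from [z] to [v]. *)
Lemma same_layer_below r x z u v : wPL_prime r ->
  above r x -> above r z -> above r u -> above r v ->
  x `<` z -> same_layer x u -> same_layer z v -> u `<=` v.
Proof.
move=> rP rx rz ru rv xz xu zv.
have uz : u `<` z.
  have uz : u `<=` z.
    have [//|xu'] := above_layered rP rx rz ru xz.
    by rewrite -(same_layer_sub xu xu'); case: xz.
  split=> // zu; have eqzu : z = u by apply/seteqP.
  by case: xu => + _; rewrite -eqzu.
have [vz|//] := above_layered rP ru rz rv uz.
by rewrite (same_layer_sub (same_layer_sym zv) vz); case: uz.
Qed.

Definition color (X : list nat) (x : set form) : {set 'I_(length X)} :=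
  finset (fun i : 'I_(length X) => `[< x (Var (List.nth i X 0%N)) >]).

Definition layer_colors X (r x : set form) : {set {set 'I_(length X)}} :=
  finset (fun c => `[< exists y, [/\ above r y, same_layer x y & color X y = c] >]).

Definition point_type X r x := (color X x, layer_colors X r x).

Lemma color_sub X x y : x `<=` y -> color X x \subset color X y.
Proof. by move=> xy; apply/fintype.subsetP => i; rewrite !inE; apply: xy. Qed.

Lemma layer_colorsP X r x c :
  reflect (exists y, [/\ above r y, same_layer x y & color X y = c])
    (c \in layer_colors X r x).
Proof. by rewrite inE; apply: asboolP. Qed.

Lemma point_type_bisim X r x y x' : wPL_prime r ->
  above r x -> above r y -> above r x' ->
  point_type X r x = point_type X r y -> x `<=` x' ->
  exists y', [/\ above r y', y `<=` y' & point_type X r y' = point_type X r x'].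
Proof.
move=> rP rx ry rx' [cxy lxy] xx'.
have [yx'|nyx'] := pselect (y `<=` x'); first by exists x'.
have [xy|nxy] := pselect (x `<` y); last first.
  have [yx|nyx] := pselect (y `<` x); first by case: nyx'; apply: subset_trans xx'; case: yx.
  exists y; split=> //; rewrite /point_type -cxy -lxy.
  suff -> : x = x' by [].
  apply/seteqP; split=> //; apply: contrapT => nx'x.
  have [//|/(same_layer_sub (conj nxy nyx)) exy] :=
    above_layered rP rx rx' ry (conj xx' nx'x).
  by case: nyx'; rewrite -exy.
exists y; split=> //.
(* The layers of [x] and [y] realize the same colors and every point of the
   former is below every point of the latter, so only one color occurs. *)
have mono v : above r v -> same_layer y v -> color X v = color X y.
  move=> rv yv; have /layer_colorsP[u [ru xu <-]] : color X v \in layer_colors X r x.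
    by rewrite lxy; apply/layer_colorsP; exists v.
  apply/eqP; rewrite finset.eqEsubset; apply/andP; split; last rewrite -cxy.
    exact/color_sub/(same_layer_below rP rx ry ru ry xy xu (same_layer_refl y)).
  have /layer_colorsP[w [rw yw <-]] : color X u \in layer_colors X r y.
    by rewrite -lxy; apply/layer_colorsP; exists u.
  exact/color_sub/(same_layer_below rP rx ry rx rw xy (same_layer_refl x) yw).
(* Since [y] is not below [x'], the layer of [x'] lies weakly between those of [x] and [y], which
   squeezes its colors. *)
have mono' v : above r v -> same_layer x' v -> color X v = color X y.
  move=> rv x'v; have [x'x|nx'x] := pselect (x' `<=` x).
    have /layer_colorsP[u [ru yu <-]] : color X v \in layer_colors X r y.
      rewrite -lxy; apply/layer_colorsP; exists v; split=> //.
      by have -> : x = x' by apply/seteqP.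
    exact: mono.
  have xv : x `<=` v.
    exact: (same_layer_below rP rx rx' rx rv (conj xx' nx'x) (same_layer_refl x)).
  have [/mono-> //|nyv] := pselect (same_layer y v).
  apply/eqP; rewrite finset.eqEsubset -{2}cxy (color_sub X xv) andbT.
  apply: color_sub; apply: contrapT => nvy; apply: nyv; split=> [yv|[]//].
  have [x'v'|//] := above_layered rP ry rv rx' yv.
  by case: nyx'; rewrite (same_layer_sub x'v x'v'); case: yv.
have layer_of t : above r t ->
    (forall v, above r v -> same_layer t v -> color X v = color X y) ->
    layer_colors X r t = finset.set1 (color X y).
  move=> rt h; apply/setP => c; rewrite finset.in_set1.
  apply/layer_colorsP/eqP => [[v [rv tv <-]]|->]; first exact: h.
  by exists t; split=> //; [apply: same_layer_refl | apply: h => //; apply: same_layer_refl].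
rewrite /point_type (mono' _ rx' (same_layer_refl x')).
by rewrite (layer_of _ ry mono) (layer_of _ rx' mono').
Qed.

(** * Local tabularity *)

Fixpoint sat (X : list nat) (T : finType) (col : T -> {set 'I_(length X)})
    (R : {set T * T}) (t : T) (f : form) : Prop :=
  match f with
  | Var n => exists2 i, i \in col t & List.nth i X 0%N = n
  | Bot => False
  | Top => True
  | And a b => sat col R t a /\ sat col R t b
  | Or a b => sat col R t a \/ sat col R t b
  | Imp a b => forall s, (t, s) \in R -> sat col R s a -> sat col R s b
  end.

Definition type_order X r :=
  finset (fun ts => `[< exists x y, [/\ above r x, above r y, x `<=` y,
    point_type X r x = ts.1 & point_type X r y = ts.2] >]).

(** [point_type] is a p-morphism onto its image: [type_order] is the image of inclusion, and
    [point_type_bisim] lifts each of its arrows to any point of the source type. *)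
Lemma truth X r x f : wPL_prime r -> incl (vars f) X -> above r x ->
  x f <-> sat fst (type_order X r) (point_type X r x) f.
Proof.
move=> rP fX; have mem y : above r y -> wPL_prime y by case.
elim: f fX x => [n|||a IHa b IHb|a IHa b IHb|a IHa b IHb] /= fX x rx;
  have xP := mem _ rx; have [xded nxBot _] := xP;
  try (have [aX bX] : incl (vars a) X /\ incl (vars b) X
    by split=> k kf; apply/fX/in_app_iff; [left | right]).
- split=> [xn|[i + <-]]; last by rewrite inE => /asboolP.
  have [i [/ssrnat.ltP iX nX]] := In_nth X n 0%N (fX n (or_introl erefl)).
  by exists (Ordinal iX) => //; rewrite inE; apply/asboolP; rewrite /= nX.
- by split.
- by split=> // _; apply: xded; apply: ded_axiom; constructor.
- by rewrite -(IHa aX) // -(IHb bX) //; apply: prime_and xP.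
- by rewrite -(IHa aX) // -(IHb bX) //; apply: prime_or xP.
- rewrite (prime_imp _ _ xP); split=> h.
    move=> s; rewrite inE => /asboolP[x0 [y0 [rx0 ry0 x0y0 /= tx0 <-]]].
    have [y [ry xy <-]] := point_type_bisim rP rx0 rx ry0 tx0 x0y0.
    by rewrite -(IHa aX) // -(IHb bX) //; apply: h => //; apply: mem.
  move=> y yP xy; have ry : above r y.
    by split=> //; case: rx => _ rx; apply: subset_trans xy.
  rewrite (IHa aX) // (IHb bX) //; apply: h.
  by rewrite inE; apply/asboolP; exists x, y; split.
Qed.

Notation ptype X := ({set 'I_(length X)} * {set {set 'I_(length X)}})%type.

(** The finite pointed models satisfying [f], each an order on types with a base type; only finitely
    many profiles exist for a given [X]. *)
Definition profile X f : {set {set ptype X * ptype X} * ptype X} :=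
  finset (fun P => `[< sat fst P.1 P.2 f >]).

Lemma profile_imp X f g : incl (vars f) X -> incl (vars g) X ->
  profile X f = profile X g -> wPL (Imp f g).
Proof.
move=> fX gX fg; apply: ded_set0; apply: deduction; apply: contrapT => nd.
have [r [rP fr]] := prime_extension nd; apply.
have rr : above r r by split.
rewrite (truth rP gX rr).
have rf : r f by apply: fr; left.
have {}rf := (truth rP fX rr).1 rf.
suff : (type_order X r, point_type X r r) \in profile X g by rewrite inE => /asboolP.
by rewrite -fg inE; apply/asboolP.
Qed.

Lemma wPL_locally_tabular : locally_tabular wPL.
Proof.
move=> X; pose realizes S f := incl (vars f) X /\ profile X f = S.
(* One formula per realized profile; unrealized profiles get the default [Bot]. *)
have /choice[rep repP] : forall S, exists f, (exists g, realizes S g) -> realizes S f.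
  move=> S; have [[f Sf]|nS] := pselect (exists g, realizes S g).
    by exists f.
  by exists Bot => h; case: nS.
exists (List.map rep (enum {: {set {set ptype X * ptype X} * ptype X}})) => f fX.
exists (rep (profile X f)); split.
  apply: in_map; have : profile X f \in enum {: {set {set ptype X * ptype X} * ptype X}}.
    by rewrite mem_enum.
  by elim: (enum _) => //= S s IH; rewrite inE => /predU1P[->|/IH]; [left | right].
have [|gX fg] := repP (profile X f); first by exists f.
apply: ThMP (profile_imp gX fX fg); apply: ThMP (profile_imp fX gX (esym fg)).
exact/ThIPC/AxA3.
Qed.

(** * Failure of uniform local tabularity *)

(* Layer [i] (with [0] on top) is an antichain of two points. *)
Definition ladder_le (x y : nat * bool) : Prop := x = y \/ (y.1 < x.1)%N.

Lemma ladder_le_trans x y z : ladder_le x y -> ladder_le y z -> ladder_le x z.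
Proof.
case=> [->//|xy] [<-|yz]; first by right.
by right; apply: ltn_trans yz xy.
Qed.

(* [Var i] is true at [(i, true)] and on all layers above it, hence [(i, false)]
   and [(i.+1, true)] satisfy the same variables. *)
Fixpoint ladder (x : nat * bool) (f : form) : Prop :=
  match f with
  | Var j => (x.1 + ~~ x.2 <= j)%N
  | Bot => False
  | Top => True
  | And a b => ladder x a /\ ladder x b
  | Or a b => ladder x a \/ ladder x b
  | Imp a b => forall y, ladder_le x y -> ladder y a -> ladder y b
  end.

Lemma ladder_persistent x y f : ladder_le x y -> ladder x f -> ladder y f.
Proof.
move=> xy; elim: f => //= [j|a IHa b IHb|a IHa b IHb|a _ b _].
- case: xy => [<-//|xy] h; apply: leq_trans h; apply: leq_trans (leq_addr _ _).
  by apply: leq_trans xy; case: y.2; rewrite ?addn0 ?addn1.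
- by case=> /IHa ha /IHb.
- by case=> [/IHa|/IHb]; [left | right].
- by move=> h z /(ladder_le_trans xy); apply: h.
Qed.

Lemma ladder_wPL x f : wPL f -> ladder x f.
Proof.
move=> h; elim: h x => {f} [f|s f -> x|a b _ hab _ ha x]; last by apply: hab (ha x); left.
  case=> /=.
  - by move=> a b x y _ ha z yz _; apply: ladder_persistent ha.
  - move=> a b c x y _ h z yz hb t zt ha.
    apply: (h _ (ladder_le_trans yz zt) ha); first by left.
    exact: hb.
  - by move=> a b x y _ [].
  - by move=> a b x y _ [].
  - by move=> a b x y _ ha z yz hb; split=> //; apply: ladder_persistent ha.
  - by move=> a b x y _; left.
  - by move=> a b x y _; right.
  - move=> a b c x y _ ha z yz hb t zt [h|h]; last exact: hb.
    by apply: ha h; apply: ladder_le_trans zt.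
  - by [].
  - by [].
rewrite /=; set p := s 0%N; set q := s 1%N.
have [|nqp] := pselect (forall y, ladder_le x y -> ladder y q -> ladder y p).
  by left.
right.
have {nqp}[w [rw wq nwp]] : exists w, [/\ ladder_le x w, ladder w q & ~ ladder w p].
  apply: contrapT => nw; apply: nqp => y ry yq; apply: contrapT => nyp.
  by apply: nw; exists y.
(* Induction from the top layer down. With [p] true on all layers above [t] but not at [t], the
   point [w] is not above [t], so [q] holds on all those layers; hence [Imp p q] holds at [t], and
   so does [p]. *)
move=> t _; have [n] := ubnP t.1; elim: n => // n IH in t *; rewrite ltnS => tn h.
have up y : (y.1 < t.1)%N -> ladder y p.
  move=> yt; apply: (IH y (leq_trans yt tn)) => z yz.
  by apply: h; apply: ladder_le_trans yz; right.
apply: contrapT => ntp; apply: (ntp).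
apply: (h t (or_introl erefl)) => z [<- //|zt] zp.
have [wz|zw] := ltnP z.1 w.1.
  by apply: ladder_persistent wq; right.
by case: nwp; apply: up; apply: leq_ltn_trans zt.
Qed.

(* In a sum of Boolean algebras generated by the variables, one in each summand,
   this is the top element of the [n]-th summand. *)
Fixpoint layer_top (n : nat) : form :=
  Or (Var n) (Imp (Var n) (if n is m.+1 then layer_top m else Bot)).

(** The point [(n, true)] satisfies [Var n]; at [(n, false)] the implication holds because [Var n]
    is true only on higher layers; every point below layer [n] sees [(n, true)], which refutes the
    implication. *)
Lemma ladder_layer_top n x : ladder x (layer_top n) <-> (x.1 <= n)%N.
Proof.
case: x; elim: n => [|n IH] i b /=.
  split=> [[|h]|]; first by apply: leq_trans; apply: leq_addr.
    case: i h => // i /(_ (0, true)); case=> //; by right.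
  rewrite leqn0 => /eqP ->; case: b; first by left.
  by right=> y [<-|].
split=> [[|h]|].
- by apply: leq_trans; apply: leq_addr.
- rewrite leqNgt; apply/negP => ni; have := h (n.+1, true) (or_intror ni).
  by rewrite IH /= addn0 ltnn => /(_ (leqnn _)).
- rewrite leq_eqVlt => /predU1P[->|]; last rewrite ltnS => ni.
    case: b; first by left; rewrite addn0.
    right=> -[j c] [<- /=|/= jn _]; first by rewrite addn1 ltnn.
    exact/IH.
  by left; case: b; rewrite ?addn0 ?addn1 //; apply: leqW.
Qed.

Lemma leq_Nat_max m n i : (Nat.max m n <= i)%N = (m <= i)%N && (n <= i)%N.
Proof.
by apply/ssrnat.leP/andP => [h|[/ssrnat.leP ? /ssrnat.leP ?]];
  [split; apply/ssrnat.leP|]; lia.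
Qed.

(** Besides itself and what [(i, false)] sees, [(i.+1, true)] sees only [(i, true)]. For [i > 0]
    that point agrees to depth [i - 1] with [(i.-1, false)], which [(i, false)] sees. *)
Lemma ladder_shallow i f : (idepth f <= i)%N ->
  ladder (i, false) f <-> ladder (i.+1, true) f.
Proof.
elim: f i => [j|||a IHa b IHb|a IHa b IHb|a IHa b IHb] i //=.
- by rewrite addn0 addn1.
- by rewrite leq_Nat_max => /andP[/IHa -> /IHb ->].
- by rewrite leq_Nat_max => /andP[/IHa -> /IHb ->].
(* An implication has positive depth, so there is a layer above the current one. *)
case: i => // i; rewrite ltnS leq_Nat_max => /andP[ai bi].
split=> h y; last first.
  by move=> xy; apply: h; apply: ladder_le_trans xy; right.
case=> [<-|]; last rewrite /= ltnS leq_eqVlt => /predU1P.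
  rewrite -(IHa i.+1) ?(leqW ai) // -(IHb i.+1) ?(leqW bi) //.
  by apply: h; left.
case: y => j c /= [->|ji]; last by apply: h; right.
case: c; last by apply: h; left.
by rewrite -(IHa i) // -(IHb i) //; apply: h; right.
Qed.

Lemma wPL_not_uniformly_locally_tabular : ~ uniformly_locally_tabular wPL.
Proof.
move=> [n /(_ (layer_top n))[g [/ssrnat.leP gn /ladder_wPL fg]]].
have fgE x : ladder x (layer_top n) <-> ladder x g.
  by have [f_g g_f] := fg x; split; [apply: f_g | apply: g_f]; left.
have := ladder_shallow gn; rewrite -!fgE !ladder_layer_top /= ltnn leqnn.
by case=> /(_ isT).
Qed.

Theorem mainTheorem13 :
  locally_tabular wPL /\ ~ uniformly_locally_tabular wPL.
Proof.
split; [exact: wPL_locally_tabular | exact: wPL_not_uniformly_locally_tabular].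
Qed.
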